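(* Let $r\ge 0$ be an integer. Then the number of points on the boundary of the closed parabolic-taxicab ball of radius $r$ and center $O=(0,0)$ is $$\#\partial\mathscr{B}_{\mathrm{pc}}(O,r)=\frac{1}{2}\big(5r^2-r\big)-\left\lceil\frac{r-1}{2}\right\rceil+\left\lceil\frac{r}{r+1}\right\rceil+1,$$ and the number of points of the entire closed ball is $$\#\mathscr{B}_{\mathrm{pc}}(O,r)=\frac{1}{12}\big(10r^3+9r^2+23r\big)+\frac{1}{2}\left\lceil\frac{r}{2}\right\rceil+1.$$
   Context: Define the following maps $\mathbb{Z}^2\to\mathbb{Z}^2$: $L'(x,y)=(-x+2y+1,y)$, $L''(x,y)=(x,2x-y+1)$, $M'(x,y)=(x+1,y)$, $M''(x,y)=(x-1,y)$, $M'''(x,y)=(x,y+1)$, $M^{iv}(x,y)=(x,y-1)$. Let $\mathcal{L}=\{L',L''\}$ and $\mathcal{M}=\{M',M'',M''',M^{iv}\}$. The parabolic-taxicab distance between $P,Q\in\mathbb{Z}^2$ is $$d_{\mathrm{pc}}(P,Q)=\min\{n\in\mathbb{Z}_{\ge 0} : \exists\, F_1,\dots,F_n\in\{\mathrm{id}\}\cup\mathcal{L}\cup\mathcal{M},\ F_1\circ\cdots\circ F_n(P)=Q\},$$ where the empty composition ($n=0$) is the identity. For $C\in\mathbb{Z}^2$ and an integer $r\ge 0$, the closed ball is $\mathscr{B}_{\mathrm{pc}}(C,r)=\{X\in\mathbb{Z}^2 : d_{\mathrm{pc}}(C,X)\le r\}$ and its boundary is $\partial\mathscr{B}_{\mathrm{pc}}(C,r)=\{X\in\mathbb{Z}^2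 : d_{\mathrm{pc}}(C,X)=r\}$. $\lceil\cdot\rceil$ is the ceiling function and $\#$ denotes cardinality. *)

(* Defs.v *)
From mathcomp Require Import all_boot all_order all_algebra archimedean finmap.
From mathcomp Require Import boolp classical_sets functions cardinality.
Set Implicit Arguments.
Unset Strict Implicit.
Unset Printing Implicit Defensive.
Import Order.TTheory GRing.Theory Num.Theory.
Local Open Scope classical_set_scope.
Local Open Scope ring_scope.

Definition Z2 : Type := (int * int)%type.

Definition L1 (P : Z2) : Z2 := (- P.1 + 2 * P.2 + 1, P.2).
Definition L2 (P : Z2) : Z2 := (P.1, 2 * P.1 - P.2 + 1).
Definition M1 (P : Z2) : Z2 := (P.1 + 1, P.2).
Definition M2 (P : Z2) : Z2 := (P.1 - 1, P.2).
Definition M3 (P : Z2) : Z2 := (P.1, P.2 + 1).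
Definition M4 (P : Z2) : Z2 := (P.1, P.2 - 1).

Definition calL : set (Z2 -> Z2) := [set L1; L2].
Definition calM : set (Z2 -> Z2) := [set M1; M2; M3; M4].

(* The big operator unfolds to F 0 \o (F 1 \o ... \o F n.-1), so the last map
   is applied to P first; for n = 0 it is the identity. *)
Definition reach (P Q : Z2) (n : nat) : Prop :=
  exists F : 'I_n -> (Z2 -> Z2),
    (forall i, ([set id] `|` calL `|` calM) (F i)) /\
    (\big[comp/id]_(i < n) F i) P = Q.

Lemma reachS P Q n F : ([set id] `|` calL `|` calM) F ->
  reach P Q n -> reach P (F Q) n.+1.
Proof.
move=> SF [G [SG <-]].
exists (fun i => if unlift ord0 i is Some j then G j else F); split.
  by move=> i; case: unlift.
rewrite big_ord_recl unlift_none /=; congr (F _).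
by congr (_ P); apply: eq_bigr => i _; rewrite liftK.
Qed.

Lemma reach_ex P Q : exists n, `[< reach P Q n >].
Proof.
suff: exists n, reach P Q n by case=> n h; exists n; apply/asboolP.
pose R X := exists n, reach P X n.
have step F X : ([set id] `|` calL `|` calM) F -> R X -> R (F X).
  by move=> SF [n h]; exists n.+1; apply: reachS.
have R0 : R P by exists 0%N, (fun _ => id); split=> [[]//|]; rewrite big_ord0.
have Mx1 : ([set id] `|` calL `|` calM) M1 by right; left; left; left.
have Mx2 : ([set id] `|` calL `|` calM) M2 by right; left; left; right.
have Mx3 : ([set id] `|` calL `|` calM) M3 by right; left; right.
have Mx4 : ([set id] `|` calL `|` calM) M4 by right; right.
have Rx (a : int) x y : R (x, y) -> R (x + a, y).
  elim: a => [|n IH|n IH] h; first by rewrite addr0.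
    by rewrite -addn1 PoszD addrA; exact: (step M1 _ Mx1 (IH h)).
  by rewrite -addn1 PoszD opprD addrA; exact: (step M2 _ Mx2 (IH h)).
have Ry (a : int) x y : R (x, y) -> R (x, y + a).
  elim: a => [|n IH|n IH] h; first by rewrite addr0.
    by rewrite -addn1 PoszD addrA; exact: (step M3 _ Mx3 (IH h)).
  by rewrite -addn1 PoszD opprD addrA; exact: (step M4 _ Mx4 (IH h)).
have : R (P.1, P.2) by rewrite -surjective_pairing.
move=> /(Rx (Q.1 - P.1))/(Ry (Q.2 - P.2)).
by rewrite !subrKC -surjective_pairing.
Qed.

Definition d_pc (P Q : Z2) : nat := ex_minn (reach_ex P Q).

Definition ball_pc (C : Z2) (r : nat) : set Z2 := [set X | (d_pc C X <= r)%N].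

Definition boundary_pc (C : Z2) (r : nat) : set Z2 := [set X | d_pc C X = r].

(* Main.v *)
(* Both reflections preserve (x-y)^2 - (x+y).  The ball of radius r is the union,
   over a + b <= r, of the segments cut out on the diagonals x - y = b - a by
     x, y <= T   and   (x-y)^2 - (x+y) <= 2T,   T = m(m+1)/2,  m = max(a, b):
   every map increases a + b by at most one, and conversely every point of a
   segment with a + b > 0 is the image of a point of a segment with a + b one
   smaller.  Since every map other than the identity changes the parity of x - y,
   the points at distance exactly r are those of the segments with a + b = r that
   do not lie on the segments with a + b = r - 2.  Passing from (a, b) to
   (a+1, b+1) adds 2(m+1) points to a segment, and summing gives the counts. *)
Require Import Defs.
From mathcomp Require Import all_boot all_order all_algebra archimedean finmap.
From mathcomp Require Import boolp classical_sets functions cardinality.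
From mathcomp Require Import zify ring lra.
Import Order.TTheory GRing.Theory Num.Theory.
Local Open Scope classical_set_scope.
Local Open Scope ring_scope.

(** * Segments and the action of the maps on them *)

Definition segment (a b : nat) (X : Z2) : Prop :=
  let: m := (maxn a b)%:Z in
  [/\ X.1 - X.2 = b%:Z - a%:Z, 2 * X.1 <= m * (m + 1), 2 * X.2 <= m * (m + 1)
    & (X.1 - X.2) ^+ 2 - (X.1 + X.2) <= m * (m + 1)].

Definition step : set (Z2 -> Z2) := [set id] `|` calL `|` calM.

Lemma segment_origin X : segment 0 0 X <-> X = (0, 0).
Proof.
case: X => x y; rewrite /segment /= maxnn; split=> [[] | [-> ->] //].
by move=> *; congr pair; nia.
Qed.

Lemma segmentSS a b X : segment a b X -> segment a.+1 b.+1 X.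
Proof.
rewrite /segment maxnSS /=; set m := maxn a b; case=> *; split; nia.
Qed.

(** Each map other than [id] changes x - y by one, after a sign change if it is a reflection; the
    sign change exchanges a and b, and the unit increases one index. *)
Lemma segment_step F a b X : step F -> segment a b X ->
  exists a' b', (a' + b' <= (a + b).+1)%N /\ segment a' b' (F X).
Proof.
case: X => x y SF rX.
have : segment a b (F (x, y)) \/ segment a.+1 b (F (x, y)) \/
    segment a b.+1 (F (x, y)) \/ segment b.+1 a (F (x, y)) \/ segment b a.+1 (F (x, y)).
  case: rX SF; rewrite /segment /= => s hx hy hq.
  by case=> [[->|[->|->]]|[[[->|->]|->]|->]];
    rewrite /L1 /L2 /M1 /M2 /M3 /M4 /=;
    [ left | do 4!right | do 3!right; left | do 2!right; left
    | right; left | right; left | do 2!right; left ];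
    (done || by case: (leqP a b) hx hy hq => ab; case: leqP => *; split; nia).
case=> [|[|[|[]]]] rF.
- by exists a, b; split=> //; lia.
- by exists a.+1, b; split=> //; lia.
- by exists a, b.+1; split=> //; lia.
- by exists b.+1, a; split=> //; lia.
- by exists b, a.+1; split=> //; lia.
Qed.

Lemma segment_pred a b X : segment a b X -> (0 < a + b)%N ->
  exists F Y a' b',
    [/\ step F, X = F Y, segment a' b' Y & (a' + b').+1 = (a + b)%N].
Proof.
have SL1 : step L1 by left; right; left.
have SL2 : step L2 by left; right; right.
have SM1 : step M1 by right; left; left; left.
have SM2 : step M2 by right; left; left; right.
have SM3 : step M3 by right; left; right.
have SM4 : step M4 by right; right.
case: X => x y; rewrite /segment /=; case=> s hx hy hq ab0.
have [ab|ab] := leqP a b.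
  rewrite (maxn_idPr ab) in hx hy hq.
  case: a => [|a] in s ab ab0 *.
    case: b => [//|b] in s ab ab0 hx hy hq *.
    (* Here m drops from b + 1 to b: a point with x within the smaller bound is translated back, and
       one beyond it is reflected back by the involution [L1]. *)
    have [xb|xb] := lerP (2 * x) (b%:Z * (b%:Z + 1)).
      exists M4, (x, y + 1), 0%N, b; split=> //; first by rewrite /M4 /= addrK.
      by rewrite max0n /=; split; nia.
    exists L1, (L1 (x, y)), b, 0%N; split=> //.
    - by rewrite /L1 /=; congr pair; lia.
    - have b2 : b%:Z <= b%:Z * b%:Z by nia.
      have -> : y = x - (b%:Z + 1) by lia.
      by rewrite maxn0 /L1 /=; split; nia.
    - by rewrite addn0.
  (* Here m stays equal to b. The involution [L2] preserves the quadratic form, so only its new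
     coordinate 2x - y + 1 can break a bound; when it does, x + y is large enough for the
     translation to keep the quadratic bound. *)
  have [xb|xb] := lerP (2 * (x + (x - y) + 1)) (b%:Z * (b%:Z + 1)).
    exists L2, (L2 (x, y)), b, a; split=> //; last by rewrite addSn addnC.
      by rewrite /L2 /=; congr pair; lia.
    by rewrite (maxn_idPl (ltnW ab)) /L2 /=; split; nia.
  exists M3, (x, y - 1), a, b; split=> //; first by rewrite /M3 /= subrK.
  by rewrite (maxn_idPr (ltnW ab)) /=; split; nia.
(* Mirror case: exchanging the coordinates exchanges a with b and [L1] with [L2]. *)
rewrite (maxn_idPl (ltnW ab)) in hx hy hq.
case: b => [|b] in s ab ab0 *.
  case: a => [//|a] in s ab ab0 hx hy hq *.
  have [yb|yb] := lerP (2 * y) (a%:Z * (a%:Z + 1)).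
    exists M2, (x + 1, y), a, 0%N; split=> //; first by rewrite /M2 /= addrK.
    by rewrite maxn0 /=; split; nia.
  exists L2, (L2 (x, y)), 0%N, a; split=> //.
  - by rewrite /L2 /=; congr pair; lia.
  - have a2 : a%:Z <= a%:Z * a%:Z by nia.
    have -> : x = y - (a%:Z + 1) by lia.
    by rewrite max0n /L2 /=; split; nia.
  - by rewrite addn0.
have ba : (b <= a)%N by lia.
have [yb|yb] := lerP (2 * (y - (x - y) + 1)) (a%:Z * (a%:Z + 1)).
  exists L1, (L1 (x, y)), b, a; split=> //; last by rewrite addnS addnC.
    by rewrite /L1 /=; congr pair; lia.
  by rewrite (maxn_idPr ba) /L1 /=; split; nia.
exists M1, (x - 1, y), a, b; split=> //; last by rewrite addnS.
  by rewrite /M1 /= subrK.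
by rewrite (maxn_idPl ba) /=; split; nia.
Qed.

(** * Distance from the origin in terms of segments *)

Lemma reach_segment r X :
  reach (0, 0) X r <-> exists a b, (a + b <= r)%N /\ segment a b X.
Proof.
split.
  case=> F [SF <-] {X}; elim: r F SF => [|r IH] F SF.
    by exists 0%N, 0%N; rewrite big_ord0; split=> //; apply/segment_origin.
  rewrite big_ord_recl /=.
  have [a [b [abr rX]]] := IH _ (fun i => SF (lift ord0 i)).
  have [a' [b' [abr' rF]]] := segment_step _ _ _ _ (SF ord0) rX.
  by exists a', b'; split=> //; lia.
elim: r X => [|r IH] X [a [b [abr rX]]].
  have [a0 b0] : a = 0%N /\ b = 0%N by lia.
  rewrite a0 b0 in rX; move/segment_origin: rX => ->.
  by exists (fun _ => id); split=> [[]//|]; rewrite big_ord0.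
have [ab0|ab0] := posnP (a + b).
  have /IH : exists a b, (a + b <= r)%N /\ segment a b X.
    by exists a, b; rewrite ab0.
  by apply: (@reachS _ _ _ id); left; left.
have [F [Y [a' [b' [SF -> rY ab']]]]] := segment_pred _ _ _ rX ab0.
by apply: reachS => //; apply: IH; exists a', b'; split=> //; lia.
Qed.

Lemma d_pc_segment r X :
  (d_pc (0%R, 0%R) X <= r)%N <-> exists a b, (a + b <= r)%N /\ segment a b X.
Proof.
rewrite /d_pc; case: ex_minnP => n /asboolP rn min_n; split=> [nr|].
  have /reach_segment [a [b [abn rX]]] := rn.
  by exists a, b; split=> //; lia.
by move=> /reach_segment/asboolP; exact: min_n.
Qed.

(** * Parametrization and size of a segment *)

Definition tri (n : nat) : nat := 'C(n.+1, 2).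

Lemma triS n : tri n.+1 = (tri n + n.+1)%N.
Proof. by rewrite /tri binS bin1. Qed.

Lemma tri_double n : (2 * tri n)%N = (n * n.+1)%N.
Proof. by elim: n => [|n IH] //; rewrite triS mulnDr IH; nia. Qed.

(** With d = |a - b| and T = [tri (maxn a b)], the larger coordinate runs from [tri d] - T to T. *)
Definition segment_size (a b : nat) : nat :=
  (2 * tri (maxn a b) - tri (maxn a b - minn a b)).+1.

(* The points are listed by decreasing larger coordinate, starting from T;
   one of the truncated differences a - b and b - a is zero. *)
Definition segment_point (a b j : nat) : Z2 :=
  ((tri (maxn a b))%:Z - (a - b)%N%:Z - j%:Z,
   (tri (maxn a b))%:Z - (b - a)%N%:Z - j%:Z).

Lemma segmentP a b X :
  segment a b X <-> exists2 j, (j < segment_size a b)%N & X = segment_point a b j.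
Proof.
case: X => x y; rewrite /segment /segment_size /segment_point /=.
set m := maxn a b; set d := (m - minn a b)%N.
have tm := tri_double m; have td := tri_double d.
have dE : d%:Z = `|a%:Z - b%:Z| by rewrite /d /m; lia.
have d2 : (d%:Z) ^+ 2 = (a%:Z - b%:Z) ^+ 2 by rewrite dE; nia.
have dm : (d <= m)%N by rewrite /d leq_subr.
have tdm : (tri d <= 2 * tri m)%N by nia.
have abd : (a - b + (b - a))%N = d by rewrite /d /m; lia.
(* On the diagonal, d^2 + d = 2 [tri d] makes the quadratic bound linear. *)
have s2 : x - y = b%:Z - a%:Z -> (x - y) ^+ 2 + d%:Z = 2 * (tri d)%:Z.
  have d2' : (b%:Z - a%:Z) ^+ 2 = d%:Z ^+ 2 by rewrite d2; ring.
  by move=> ->; rewrite d2'; nia.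
have -> : m%:Z * (m%:Z + 1) = 2 * (tri m)%:Z by clear -tm; lia.
clear tm td d2 dm; split=> [[s hx hy hq]|[j hj [xE yE]]].
  have {s2} := s2 s.
  have [j jE] : exists j : nat, j%:Z = (tri m)%:Z - (a - b)%N%:Z - x.
    by exists (absz ((tri m)%:Z - (a - b)%N%:Z - x)%R); rewrite gez0_abs //; lia.
  by exists j; [lia | congr pair; lia].
have s : x - y = b%:Z - a%:Z by lia.
have {}s2 := s2 s.
by split; lia.
Qed.

(** * Shells: the segments with a + b = k *)

Definition shell (k : nat) : seq Z2 :=
  [seq segment_point a (k - a) j
     | a <- iota 0 k.+1, j <- iota 0 (segment_size a (k - a))].

Lemma mem_shell k X :
  X \in shell k <-> exists a b, (a + b)%N = k /\ segment a b X.
Proof.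
split=> [/allpairsPdep [a [j []]]|[a [b [<- /segmentP[j hj ->]]]]].
  rewrite !mem_iota !add0n /= => ak hj ->.
  by exists a, (k - a)%N; split; [lia | apply/segmentP; exists j].
apply/allpairsPdep; exists a, j; rewrite !mem_iota !add0n /= addKn.
by split=> //; lia.
Qed.

(** Distinct a give distinct diagonals x - y = k - 2a, and along one diagonal j is determined by a
    coordinate. *)
Lemma shell_uniq k : uniq (shell k).
Proof.
apply: allpairs_uniq_dep => [|a _|]; [exact: iota_uniq | exact: iota_uniq |].
move=> [a j] [a' j'] /allpairsPdep[a1 [j1 [+ _ [e1 e2]]]].
move=> + /allpairsPdep[a2 [j2 [+ _ [e3 e4]]]].
rewrite !mem_iota !add0n /= => h1 h2; rewrite /segment_point /= => -[ex ey].
rewrite -e1 -e3 in h1 h2.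
have aa : a = a' by lia.
rewrite -{}aa in ex *; congr existT; lia.
Qed.

Lemma size_shell k : size (shell k) = (\sum_(a < k.+1) segment_size a (k - a))%N.
Proof.
rewrite size_allpairs_dep sumnE big_map.
have -> : iota 0 k.+1 = index_iota 0 k.+1 by rewrite /index_iota subn0.
rewrite big_mkord.
by apply: eq_bigr => a _; rewrite size_iota.
Qed.

(** The gap |a - b| is unchanged, while T, counted twice, grows by m + 1. *)
Lemma segment_sizeSS a b :
  segment_size a.+1 b.+1 = (segment_size a b + 2 * (maxn a b).+1)%N.
Proof.
rewrite /segment_size maxnSS minnSS subSS triS.
set m := maxn a b; set d := (m - minn a b)%N.
have tm := tri_double m; have td := tri_double d.
have dm : (d <= m)%N by rewrite /d leq_subr.
nia.
Qed.

(** Induction by steps of two: for k + 2 both end terms equal k + 2, and the inner terms are those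
    for k raised by one. *)
Lemma sum_maxn k :
  (4 * \sum_(a < k.+1) maxn a (k - a) = 3 * k ^ 2 + 4 * k + odd k)%N.
Proof.
elim/ltn_ind: k => -[|[|k]] IH.
- by rewrite big_ord_recl big_ord0.
- by rewrite !big_ord_recl big_ord0.
rewrite big_ord_recl big_ord_recr /= max0n subn0 /bump /= add1n subnn maxn0.
rewrite (eq_bigr (fun a : 'I_k.+1 => maxn a (k - a) + 1)%N); last first.
  by move=> a _; have := ltn_ord a; rewrite /bump /=; lia.
rewrite big_split /= sum1_card card_ord.
have := IH k (leqnSn _); rewrite negbK; set S := (\sum_(a < _) _)%N => IHk.
by rewrite !mulnDr IHk -!mulnn; nia.
Qed.

(** The inner segments of shell k + 2 are those of shell k with both indices raised; each of the two
    outer ones has [tri k.+2] + 1 points. *)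
Lemma size_shellSS k :
  (2 * size (shell k.+2) = 2 * size (shell k) + 5 * k ^ 2 + 18 * k + 20 + odd k)%N.
Proof.
rewrite !size_shell big_ord_recl big_ord_recr /= subn0 /bump /= add1n subnn.
rewrite (eq_bigr (fun a : 'I_k.+1 =>
  segment_size a (k - a) + 2 * (maxn a (k - a) + 1))%N); last first.
  by move=> a _; rewrite /bump /= add1n subSS subSn ?segment_sizeSS ?addn1 // -ltnS.
rewrite big_split /= -big_distrr /= big_split /= sum1_card card_ord.
have := sum_maxn k; have := tri_double k.+2.
set S1 := (\sum_(a < _) segment_size _ _)%N.
set S2 := (\sum_(a < _) maxn _ _)%N.
rewrite /segment_size max0n min0n maxn0 minn0 subn0; set T := tri _.
by rewrite -!mulnn; nia.
Qed.

(** * Nesting and parity of shells, and exact distances *)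

Lemma sub_shellSS k : {subset shell k <= shell k.+2}.
Proof.
move=> X /mem_shell [a [b [<- sX]]]; apply/mem_shell; exists a.+1, b.+1.
by split; [rewrite addSn addnS | exact: segmentSS].
Qed.

Lemma sub_shell k l X :
  X \in shell k -> (k <= l)%N -> odd k = odd l -> X \in shell l.
Proof.
move=> sX kl okl; have -> : l = (k + (l - k)./2.*2)%N by lia.
elim: (_./2) => [|n IH]; first by rewrite addn0.
by rewrite doubleS !addnS; exact: sub_shellSS.
Qed.

(** On a segment x - y = b - a, which has the parity of a + b. *)
Lemma shell_parity k l X : X \in shell k -> X \in shell l -> odd k = odd l.
Proof.
move=> /mem_shell [a [b [<- [s _ _ _]]]] /mem_shell [a' [b' [<- [s' _ _ _]]]].
by lia.
Qed.

Lemma d_pcP r X :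
  (d_pc (0%R, 0%R) X <= r)%N <-> exists2 k, (k <= r)%N & X \in shell k.
Proof.
rewrite d_pc_segment; split=> [[a [b [abr sX]]]|[k kr /mem_shell [a [b [abk sX]]]]].
  by exists (a + b)%N => //; apply/mem_shell; exists a, b.
by exists a, b; rewrite abk.
Qed.

Lemma d_pc_eq0 X : d_pc (0%R, 0%R) X = 0%N <-> X \in shell 0.
Proof.
split=> [d0|X0]; last first.
  by apply/eqP; rewrite -leqn0; apply/d_pcP; exists 0%N.
have /d_pcP [k] : (d_pc (0%R, 0%R) X <= 0)%N by rewrite d0.
by rewrite leqn0 => /eqP ->.
Qed.

Lemma d_pc_eq1 X : d_pc (0%R, 0%R) X = 1%N <-> X \in shell 1.
Proof.
split=> [d1|X1].
  have /d_pcP [[|[|k]]//= _ X0] : (d_pc (0%R, 0%R) X <= 1)%N by rewrite d1.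
  by move/d_pc_eq0: X0; rewrite d1.
have /d_pcP : exists2 k, (k <= 1)%N & X \in shell k by exists 1%N.
case E : (d_pc _ _) => [|[|n]] // _.
by move/d_pc_eq0: E => /shell_parity/(_ X1).
Qed.

Lemma d_pc_eqSS r X :
  d_pc (0%R, 0%R) X = r.+2 <-> X \in shell r.+2 /\ X \notin shell r.
Proof.
split=> [dX|[Xr2 Xr]].
  have /d_pcP [k kr Xk] : (d_pc (0%R, 0%R) X <= r.+2)%N by rewrite dX.
  have kE : k = r.+2.
    apply/eqP; rewrite eqn_leq kr /= -dX; apply/d_pcP; exact: (ex_intro2 _ _ k).
  rewrite -kE; split=> //; apply/negP => Xr.
  have /d_pcP : exists2 k, (k <= r)%N & X \in shell k by exists r.
  by rewrite dX; lia.
have /d_pcP : exists2 k, (k <= r.+2)%N & X \in shell k by exists r.+2.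
rewrite leq_eqVlt => /orP [/eqP //|]; rewrite ltnS => /d_pcP [k kr Xk].
(* So far k is at most r + 1; parity excludes r + 1, and nesting then puts the point in shell r. *)
have ok : odd k = odd r by rewrite (shell_parity _ _ _ Xk Xr2) /= negbK.
by case/negP: Xr; apply: (sub_shell _ _ _ Xk _ ok); lia.
Qed.

(** * Enumeration of boundaries and balls *)

(** The count is doubled and free of subtraction; [r./2] and [0 < r] stand for the two ceilings. *)
Lemma boundary_enum r : exists s : seq Z2,
  [/\ uniq s, forall X, X \in s <-> d_pc (0%R, 0%R) X = r &
    (2 * size s + r + 2 * r./2 = 5 * r ^ 2 + 2 * (0 < r) + 2)%N].
Proof.
case: r => [|[|r]].
- by exists (shell 0); split=> // X; rewrite d_pc_eq0.
- by exists (shell 1); split=> // X; rewrite d_pc_eq1.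
exists [seq X <- shell r.+2 | X \notin shell r]; split.
- exact/filter_uniq/shell_uniq.
- by move=> X; rewrite mem_filter d_pc_eqSS andbC; split=> /andP.
(* As shell r is contained in shell r + 2, the difference of sizes counts the remaining points. *)
have := count_predC (mem (shell r)) (shell r.+2).
rewrite -!size_filter; set s := filter (predC _) _.
have /perm_size -> : perm_eq (filter (mem (shell r)) (shell r.+2)) (shell r).
  apply: uniq_perm; [exact/filter_uniq/shell_uniq | exact: shell_uniq | move=> X].
  by rewrite mem_filter inE; apply: andb_idr; exact: sub_shellSS.
move: (size_shellSS r); rewrite -!mulnn.
set A := size (shell r.+2); set B := size (shell r); set C := size s; nia.
Qed.

Lemma ball_enum r : exists s : seq Z2,
  [/\ uniq s, forall X, X \in s <-> (d_pc (0%R, 0%R) X <= r)%N &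
    (12 * size s = 10 * r ^ 3 + 9 * r ^ 2 + 23 * r + 6 * uphalf r + 12)%N].
Proof.
elim: r => [|r [s [us sP ss]]].
  have [s [us sP ss]] := boundary_enum 0; exists s; split=> // [X|]; last by lia.
  by rewrite sP; split=> [->|] //; rewrite leqn0 => /eqP.
have [t [ut tP st]] := boundary_enum r.+1; exists (s ++ t); split.
- rewrite cat_uniq us ut andbT /=; apply/hasPn => X /tP dX.
  by apply/negP => /sP; rewrite dX ltnn.
- move=> X; rewrite mem_cat leq_eqVlt ltnS; split=> /orP [] h; apply/orP.
  + by right; apply/sP.
  + by left; apply/eqP/tP.
  + by right; apply/tP/eqP.
  + by left; apply/sP.
have r3 : (r.+1 ^ 3 = r ^ 3 + 3 * r ^ 2 + 3 * r + 1)%N by ring.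
have r2 : (r.+1 ^ 2 = r ^ 2 + 2 * r + 1)%N by ring.
rewrite size_cat; move: ss st; rewrite {}r3 {}r2.
(* With the powers of r abstracted, the recurrence is linear. *)
move: (size s) (size t) (r ^ 3)%N (r ^ 2)%N; clear; lia.
Qed.

(** * Cardinalities and ceilings over the rationals *)

Lemma card_fset_set_seq (A : set Z2) (s : seq Z2) : uniq s ->
  (forall X, X \in s <-> A X) -> finite_set A /\ #|` fset_set A| = size s.
Proof.
move=> us sA; have AE : A = [set` s] by apply/seteqP; split=> X /sA.
have fA : finite_set A by rewrite AE; exact: finite_seq.
split=> //; apply/perm_size/uniq_perm => // X.
by rewrite in_fset_set // AE; apply/idP/idP; rewrite inE.
Qed.

Lemma ceil_half (n : nat) : Num.ceil (n%:R / 2 : rat) = uphalf n.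
Proof.
have /(congr1 (fun m => m%:R : rat)) : (2 * uphalf n = n + odd n)%N by lia.
rewrite natrM natrD => nE; apply: ceil_def; rewrite intrB -!pmulrn.
by case: (odd n) nE => /= nE; lra.
Qed.

Theorem theorem2 (r : nat) :
  let O : Z2 := (0, 0) in
  let q : rat := r%:R in
  (finite_set (boundary_pc O r) /\
   #|` fset_set (boundary_pc O r)|%:R =
     1 / 2 * (5 * q ^+ 2 - q) - (Num.ceil ((q - 1) / 2))%:~R
       + (Num.ceil (q / (q + 1)))%:~R + 1 :> rat) /\
  (finite_set (ball_pc O r) /\
   #|` fset_set (ball_pc O r)|%:R =
     1 / 12 * (10 * q ^+ 3 + 9 * q ^+ 2 + 23 * q)
       + 1 / 2 * (Num.ceil (q / 2))%:~R + 1 :> rat).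
Proof.
move=> O q.
have [s [us sP ss]] := boundary_enum r.
have [t [ut tP tt]] := ball_enum r.
have [fs ->] := card_fset_set_seq (boundary_pc O r) s us sP.
have [ft ->] := card_fset_set_seq (ball_pc O r) t ut tP.
split; split=> //.
  (* At r = 0 this is the ceiling of -1/2, which is 0; at r = n + 1 it is [uphalf n]. *)
  have -> : Num.ceil ((q - 1) / 2) = r./2.
    rewrite {}/q; case: (r) => [|n]; first by apply: ceil_def; rewrite intrB /=; lra.
    by rewrite -natr1 addrK ceil_half.
  (* The quotient is 0 at r = 0 and lies strictly between 0 and 1 otherwise. *)
  have -> : Num.ceil (q / (q + 1)) = (0 < r)%N.
    rewrite {}/q; case: (r) => [|n]; first by rewrite mul0r ceil0.
    have n0 := ler0n rat n; rewrite -natr1; apply: ceil_def.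
    rewrite subrr mulr0z -pmulrn /=.
    by apply/andP; split; [apply: divr_gt0 | rewrite ler_pdivrMr]; lra.
  have := congr1 (fun n => n%:R : rat) ss.
  by rewrite !(natrD, natrM, natrX) -/q -!pmulrn; lra.
have := congr1 (fun n => n%:R : rat) tt.
by rewrite ceil_half !(natrD, natrM, natrX) -/q -!pmulrn; lra.
Qed.
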